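(* Let $X$ be a rack and $A$ an associative algebra. The cochain complex $\{C^n(N(X),A),d^n\}_{n\in\mathbb{N}}$ provided with the products defined, for $f_1\in C^{p_1}(N(X),A)$ and $f_2\in C^{p_2}(N(X),A)$, by $$f_1\succ f_2=\sum_{\sigma\in\mathrm{Sh}_{p_1,p_2}^{p_1+p_2}}\epsilon(\sigma)\,\mu_A\circ(f_1\times f_2)\circ\rho_\sigma,\qquad f_1\prec f_2=\sum_{\sigma\in\mathrm{Sh}_{p_1,p_2}^{p_1}}\epsilon(\sigma)\,\mu_A\circ(f_1\times f_2)\circ\rho_\sigma$$ is a differential graded dendriform algebra.
   Context: A rack is a set $X$ with a binary operation $\rhd$ such that $x\rhd(y\rhd z)=(x\rhd y)\rhd(x\rhd z)$ and each map $y\mapsto x\rhd y$ is bijective. $A$ is an associative algebra over a commutative ring, with product $\mu_A:A\times A\to A$. $\mathbb{N}=\{0,1,2,\dots\}$. Trunks. For a directed graph with edge set $E$, source $s$ and target $t$, let $\mathrm{S}$ be the set of quadruples $(a,b,c,d)$ of edges with $s(a)=s(c)$, $t(a)=s(b)$, $t(c)=s(d)$, $t(b)=t(d)$. A trunk is a directed graph with a subset $\Gamma\subseteq\mathrm{S}$ of ''preferred squares''. A trunk map is a graph map sending preferred squares to preferred squares. The cube $\square_n$ is the trunk whose vertices are the subsets of $\{1,\dots,n\}$, whose edges are the pairs $A\to A\amalg\{k\}$ with $k\notin A$, and whose preferred squares are $$\big(A\to A\amalg\{k\},\ A\amalg\{k\}\to A\amalg\{k,l\},\ A\to A\amalg\{l\},\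 A\amalg\{l\}\to A\amalg\{k,l\}\big),\quad k<l,\ k,l\notin A.$$ For $1\le i\le n$ and $\epsilon\in\{0,1\}$ the face map $\partial_{i,\epsilon}^n:\square_{n-1}\to\square_n$ is the trunk map given on vertices by $\partial_{i,0}^n(A)=\{a\in A: a<i\}\amalg\{a+1: a\in A, a\ge i\}$ and $\partial_{i,1}^n(A)=\partial_{i,0}^n(A)\amalg\{i\}$. The trunk of the rack $X$, also denoted $X$, has one vertex, edge set $X$, and preferred squares $(a,b,a\rhd b,a)$ for $a,b\in X$. The nerve: $N(X)(\square_n)$ is the set of trunk maps $\square_n\to X$, and $(\partial_{i,\epsilon}^n)^*:N(X)(\square_n)\to N(X)(\square_{n-1})$, $F\mapsto F\circ\partial_{i,\epsilon}^n$. $C^n(N(X),A)$ is the set of all maps $N(X)(\square_n)\to A$, and $d^{n}:C^{n-1}(N(X),A)\to C^{n}(N(X),A)$ is $d^nf=\sum_{i=1}^n(-1)^i\big(f\circ(\partial_{i,0}^n)^*-f\circ(\partial_{i,1}^n)^*\big)$. Shuffles. $\mathrm{Sh}_{p_1,p_2}$ is the set of permutations $\sigma$ of $\{1,\dots,p_1+p_2\}$ with $\sigma(1)<\dots<\sigma(p_1)$ and $\sigma(p_1+1)<\dots<\sigma(p_1+p_2)$; $\epsilon(\sigma)$ is the sign. For $p_1,p_2\ge1$, $\mathrm{Sh}_{p_1,p_2}^{p_1}$ is the subset with $\sigma(p_1)=p_1+p_2$ and $\mathrm{Sh}_{p_1,p_2}^{p_1+p_2}$ the subset with $\sigma(p_1+p_2)=p_1+p_2$.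 Conventions when an index is $0$: if $p_1=0$ then $\mathrm{Sh}_{0,p_2}^{p_1+p_2}=\{\mathrm{id}\}$ and $\mathrm{Sh}_{0,p_2}^{p_1}=\emptyset$ (including $p_2=0$); if $p_1\ge1$, $p_2=0$ then $\mathrm{Sh}_{p_1,0}^{p_1}=\{\mathrm{id}\}$ and $\mathrm{Sh}_{p_1,0}^{p_1+p_2}=\emptyset$. For $\sigma\in\mathrm{Sh}_{p_1,p_2}$ the trunk maps $\sigma\circ i_{p_1}:\square_{p_1}\to\square_{p_1+p_2}$ and $\sigma\circ i_{p_2}:\square_{p_2}\to\square_{p_1+p_2}$ are given on vertices by $(\sigma\circ i_{p_1})(A)=\{\sigma(a):a\in A\}$ and $(\sigma\circ i_{p_2})(A)=\{\sigma(1),\dots,\sigma(p_1)\}\cup\{\sigma(p_1+a):a\in A\}$. The map $\rho_\sigma:N(X)(\square_{p_1+p_2})\to N(X)(\square_{p_1})\times N(X)(\square_{p_2})$ is $\rho_\sigma(F)=(F\circ\sigma\circ i_{p_1},\,F\circ\sigma\circ i_{p_2})$. A graded dendriform algebra is a graded module $D$ with two degree-preserving linear maps $\succ,\prec:D\otimes D\to D$ satisfying for all $x,y,z$: $x\succ(y\succ z)=(x\succ y)\succ z+(x\prec y)\succ z$; $(x\succ y)\prec z=x\succ(y\prec z)$; $(x\prec y)\prec z=x\prec(y\prec z)+x\prec(y\succ z)$. It is a differential graded dendriform algebra if it carries a differential $d$ of degree $+1$ with $d(x\succ y)=(dx)\succ y+(-1)^{p}x\succ(dy)$ and $d(x\prec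 y)=(dx)\prec y+(-1)^{p}x\prec(dy)$ for $x$ of degree $p$. *)

(* Defs.v *)
From HB Require Import structures.
From mathcomp Require Import all_boot all_order all_fingroup all_algebra.
(* [functions] provides the pointwise [lmodType] structure on [T -> V]. *)
From mathcomp Require Import functions.

Set Implicit Arguments.
Unset Strict Implicit.
Unset Printing Implicit Defensive.

Import GRing.Theory.

Local Open Scope ring_scope.

#[local] Obligation Tactic := idtac.

(** * Racks *)

Record rack := Rack {
  rack_sort :> Type;
  rack_op : rack_sort -> rack_sort -> rack_sort;
  rack_distr : forall x y z,
    rack_op x (rack_op y z) = rack_op (rack_op x y) (rack_op x z);
  rack_bij : forall x, bijective (rack_op x) }.

(** * Trunks *)

Definition is_square (V E : Type) (s t : E -> V) (a b c d : E) : Prop :=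
  [/\ s a = s c, t a = s b, t c = s d & t b = t d].

Record trunk := Trunk {
  vertex : Type;
  edge : Type;
  src : edge -> vertex;
  tgt : edge -> vertex;
  preferred : edge -> edge -> edge -> edge -> Prop;
  preferred_square : forall a b c d,
    preferred a b c d -> is_square src tgt a b c d }.

Record trunk_map (S T : trunk) := TrunkMap {
  vmap : vertex S -> vertex T;
  emap : edge S -> edge T;
  src_emap : forall e, src (emap e) = vmap (src e);
  tgt_emap : forall e, tgt (emap e) = vmap (tgt e);
  preferred_emap : forall a b c d, preferred a b c d ->
    preferred (emap a) (emap b) (emap c) (emap d) }.

Program Definition trunk_comp (S T U : trunk)
    (g : trunk_map T U) (f : trunk_map S T) : trunk_map S U :=
  @TrunkMap S U (vmap g \o vmap f) (emap g \o emap f) _ _ _.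
Next Obligation. by move=> S T U g f e; rewrite /= !src_emap. Qed.
Next Obligation. by move=> S T U g f e; rewrite /= !tgt_emap. Qed.
Next Obligation.
by move=> S T U g f a b c d abcd; do 2!apply: preferred_emap.
Qed.

Program Definition rack_trunk (X : rack) : trunk :=
  @Trunk unit X (fun=> tt) (fun=> tt)
    (fun a b c d => c = rack_op a b /\ d = a) _.
Next Obligation. by []. Qed.

(** * Cubes

    Indices are shifted to start at 0: the directions of the [n]-cube are the
    elements of ['I_n], and [(A, k)] encodes the edge from [A] to [k |: A]. *)

Definition cube_edge (n : nat) : Type :=
  {e : {set 'I_n} * 'I_n | e.2 \notin e.1}.

Definition cube_src n (e : cube_edge n) : {set 'I_n} := (val e).1.
Definition cube_tgt n (e : cube_edge n) : {set 'I_n} := (val e).2 |: (val e).1.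

Definition cube_preferred n (a b c d : cube_edge n) : Prop :=
  exists (A : {set 'I_n}) (k l : 'I_n),
    [/\ (k < l)%N, k \notin A & l \notin A] /\
    [/\ val a = (A, k), val b = (k |: A, l),
        val c = (A, l) & val d = (l |: A, k)].

Program Definition cube (n : nat) : trunk :=
  @Trunk {set 'I_n} (cube_edge n) (@cube_src n) (@cube_tgt n)
    (@cube_preferred n) _.
Next Obligation.
move=> n a b c d [A [k [l [_ [ea eb ec ed]]]]].
by split; rewrite /cube_src /cube_tgt ?ea ?eb ?ec ?ed //= setUCA.
Qed.

(* The map of cubes [A |-> B :|: phi @: A] on vertices (which determines it on
   edges); faces and shuffles are both of this form. *)
Section CubeMap.
Variables (m n : nat) (phi : 'I_m -> 'I_n) (B : {set 'I_n}).
Hypothesis phi_incr : {homo phi : a b / (a < b)%N}.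
Hypothesis phiB : forall a, phi a \notin B.

Definition cube_map_vertex (A : {set 'I_m}) : {set 'I_n} := B :|: phi @: A.

Lemma incr_inj : injective phi.
Proof.
move=> a b eab; apply/val_inj; case: (ltngtP a b) => // /phi_incr;
by rewrite eab ltnn.
Qed.

Lemma cube_map_notin (A : {set 'I_m}) k :
  k \notin A -> phi k \notin cube_map_vertex A.
Proof. by rewrite inE negb_or phiB (mem_imset _ _ incr_inj). Qed.

Definition cube_map_edge (e : cube_edge m) : cube_edge n :=
  exist _ (cube_map_vertex (val e).1, phi (val e).2)
    (cube_map_notin (valP e)).

Lemma cube_map_vertexU1 k A :
  cube_map_vertex (k |: A) = phi k |: cube_map_vertex A.
Proof. by rewrite /cube_map_vertex imsetU1 setUCA. Qed.

Program Definition cube_map : trunk_map (cube m) (cube n) :=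
  @TrunkMap (cube m) (cube n) cube_map_vertex cube_map_edge _ _ _.
Next Obligation. by []. Qed.
Next Obligation. by move=> e; rewrite /= /cube_tgt /= cube_map_vertexU1. Qed.
Next Obligation.
move=> a b c d [A [k [l [[kl kA lA] [ea eb ec ed]]]]].
exists (cube_map_vertex A), (phi k), (phi l); split.
  by split; [exact: phi_incr | exact: cube_map_notin | exact: cube_map_notin].
by split; rewrite /= ?ea ?eb ?ec ?ed //= cube_map_vertexU1.
Qed.

End CubeMap.

Definition face_base n (i : 'I_n.+1) (eps : bool) : {set 'I_n.+1} :=
  if eps then [set i] else set0.

Lemma lift_incr n (i : 'I_n.+1) : {homo lift i : a b / (a < b)%N}.
Proof. by move=> a b; rewrite /= !ltnNge leq_bump2. Qed.

Lemma lift_face_base n (i : 'I_n.+1) eps a : lift i a \notin face_base i eps.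
Proof. by case: eps; rewrite inE // eq_sym neq_lift. Qed.

(* [lift i] skips the value [i]. *)
Definition face n (i : 'I_n.+1) (eps : bool) : trunk_map (cube n) (cube n.+1) :=
  cube_map (@lift_incr n i) (lift_face_base i eps).

(** * The nerve and its cochains *)

Definition nerve (X : rack) (n : nat) : Type :=
  trunk_map (cube n) (rack_trunk X).

Definition nerve_face (X : rack) n (i : 'I_n.+1) (eps : bool)
    (F : nerve X n.+1) : nerve X n :=
  trunk_comp F (face i eps).

Definition cochain (k : comPzRingType) (X : rack) (A : lmodType k) (n : nat) :
    lmodType k :=
  (nerve X n -> A : lmodType k).

(* The exponent is [i.+1] because [i] starts at 0. *)
Definition cochain_d (k : comPzRingType) (X : rack) (A : lmodType k) (n : nat)
    (f : cochain X A n) : cochain X A n.+1 :=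
  \sum_(i < n.+1) (-1) ^+ i.+1 *:
    ((f \o @nerve_face X n i false) - (f \o @nerve_face X n i true)).

(** * Shuffles *)

Definition is_shuffle p q (s : 'S_(p + q)) : bool :=
  [forall a : 'I_p, forall b : 'I_p,
     (a < b)%N ==> (s (lshift q a) < s (lshift q b))%N] &&
  [forall a : 'I_q, forall b : 'I_q,
     (a < b)%N ==> (s (rshift p a) < s (rshift p b))%N].

Definition shuffle (p q : nat) := {s : 'S_(p + q) | is_shuffle s}.

(* [Sh_{p,q}^p]: the maximum is attained at the end of the first block. *)
Definition last_in_left p q (s : 'S_(p + q)) : bool :=
  if p == 0%N then false
  else if q == 0%N then s == 1%g
  else [forall i : 'I_(p + q), (i.+1 == p) ==> ((s i).+1 == p + q)%N].

(* [Sh_{p,q}^{p+q}]: the maximum is attained at the end of the second block. *)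
Definition last_in_right p q (s : 'S_(p + q)) : bool :=
  if p == 0%N then s == 1%g
  else if q == 0%N then false
  else [forall i : 'I_(p + q), (i.+1 == p + q)%N ==> ((s i).+1 == p + q)%N].

Section ShuffleMaps.
Variables (p q : nat) (s : shuffle p q).

Lemma shuffle_incrl : {homo (fun a => val s (lshift q a)) : a b / (a < b)%N}.
Proof.
by move=> a b; have /andP[/forallP/(_ a)/forallP/(_ b)/implyP] := valP s.
Qed.

Lemma shuffle_incrr : {homo (fun a => val s (rshift p a)) : a b / (a < b)%N}.
Proof.
by move=> a b; have /andP[_ /forallP/(_ a)/forallP/(_ b)/implyP] := valP s.
Qed.

Definition shuffle_base : {set 'I_(p + q)} :=
  [set val s (lshift q a) | a : 'I_p].

Lemma shuffle_notin0 (a : 'I_p) : val s (lshift q a) \notin set0.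
Proof. by rewrite inE. Qed.

Lemma shuffle_notin_base (a : 'I_q) : val s (rshift p a) \notin shuffle_base.
Proof.
by apply/imsetP => -[b _ /perm_inj/eqP]; rewrite eq_rlshift.
Qed.

Definition shuffle_left : trunk_map (cube p) (cube (p + q)) :=
  cube_map shuffle_incrl shuffle_notin0.

Definition shuffle_right : trunk_map (cube q) (cube (p + q)) :=
  cube_map shuffle_incrr shuffle_notin_base.

Definition rho (X : rack) (F : nerve X (p + q)) : nerve X p * nerve X q :=
  (trunk_comp F shuffle_left, trunk_comp F shuffle_right).

End ShuffleMaps.

(** * The half-products *)

Section HalfProducts.
Variables (k : comPzRingType) (X : rack) (A : lmodType k) (mu : A -> A -> A).
Variables (p q : nat) (f : cochain X A p) (g : cochain X A q).

Definition shuffle_term (s : shuffle p q) : cochain X A (p + q) :=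
  fun F => mu (f (rho s F).1) (g (rho s F).2).

(* [(-1) ^+ val s] is the sign of the permutation [val s], through the coercion
   [odd_perm]. *)
Definition succ_prod : cochain X A (p + q) :=
  \sum_(s : shuffle p q | last_in_right (val s))
    (-1) ^+ (val s) *: shuffle_term s.

Definition prec_prod : cochain X A (p + q) :=
  \sum_(s : shuffle p q | last_in_left (val s))
    (-1) ^+ (val s) *: shuffle_term s.

End HalfProducts.

(** * Differential graded dendriform algebras *)

Definition is_bilinear (k : pzRingType) (U V W : lmodType k)
    (f : U -> V -> W) : Prop :=
  (forall v, linear (f ^~ v)) /\ (forall u, linear (f u)).

(* A graded module is given by its homogeneous components [D n], a
   degree-preserving linear map [D (x) D -> D] by bilinear maps
   [D p -> D q -> D (p + q)]; identities between homogeneous elements whose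
   degrees are only propositionally equal are stated through [deg_cast]. *)
Definition deg_cast (k : pzRingType) (D : nat -> lmodType k) m n (e : m = n)
    (x : D m) : D n :=
  ecast i (D i) e x.

Section Dendriform.
Variables (k : pzRingType) (D : nat -> lmodType k).
Variables (succ prec : forall p q, D p -> D q -> D (p + q)%N).

Local Notation "x ≻ y" := (succ x y) (at level 45, no associativity).
Local Notation "x ≺ y" := (prec x y) (at level 45, no associativity).

Record graded_dendriform : Prop := GradedDendriform {
  dend_succ_bilinear : forall p q, is_bilinear (@succ p q);
  dend_prec_bilinear : forall p q, is_bilinear (@prec p q);
  dend_succ_succ : forall p q r (x : D p) (y : D q) (z : D r),
    deg_cast (addnA p q r) (x ≻ (y ≻ z)) =
    ((x ≻ y) ≻ z) + ((x ≺ y) ≻ z);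
  dend_succ_prec : forall p q r (x : D p) (y : D q) (z : D r),
    (x ≻ y) ≺ z = deg_cast (addnA p q r) (x ≻ (y ≺ z));
  dend_prec_prec : forall p q r (x : D p) (y : D q) (z : D r),
    (x ≺ y) ≺ z =
    deg_cast (addnA p q r) ((x ≺ (y ≺ z)) + (x ≺ (y ≻ z))) }.

Variable d : forall n, D n -> D n.+1.

(* [p.+1 + q] is convertible to [(p + q).+1], so only [p + q.+1] needs a cast. *)
Record dg_dendriform : Prop := DGDendriform {
  dgd_dendriform : graded_dendriform;
  dgd_linear : forall n, linear (@d n);
  dgd_square : forall n (x : D n), d (d x) = 0;
  dgd_succ : forall p q (x : D p) (y : D q),
    d (x ≻ y) =
    (d x ≻ y) + (-1) ^+ p *: deg_cast (addnS p q) (x ≻ d y);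
  dgd_prec : forall p q (x : D p) (y : D q),
    d (x ≺ y) =
    (d x ≺ y) + (-1) ^+ p *: deg_cast (addnS p q) (x ≺ d y) }.

End Dendriform.

(* Main.v *)
Require Import Defs.
From mathcomp Require Import all_boot all_order all_fingroup all_algebra.
From mathcomp Require Import functions.
From mathcomp Require Import boolp zify.

(** A shuffle is determined by the set [S] of the directions that it lists
    first, so both half-products are sums over subsets. To iterate this,
    cochains are evaluated on all faces of one fixed cube [F]:
    [cochain_at f F T B] is the value of [f] on the face of [F] with set of
    directions [T] and base vertex [B], and it is 0 when [#|T|] is not the
    degree of [f]. These values determine a cochain ([cochain_atP]), and they do
    not change when a cochain is transported along an equality of degrees.

    In these terms ([at_half]), the value of a product on [(T, B)] is a sum over
    the partitions of [T] into [S] and its complement [R], with sign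
    [(-1) ^+ inversions S R], where the first factor is evaluated on [(S, B)]
    and the second one on [(R, S :|: B)]. The left half-product keeps the
    partitions with the largest element of [T] in [S], and the right
    half-product keeps the others.

    - Dendriform identities: both sides are sums over the partitions of [T] into
      three sets [U], [V], [W] ([at_half_left], [at_half_right]). The signs
      agree because the number of inversions is additive in each argument, and
      the conditions agree because both say in which of the three sets the
      largest element of [T] lies.

    - Leibniz rule: by [at_d], the value of the differential of the product of
      [x] and [y] is a sum over a direction [i] of [T] and a partition of
      [T :\ i] into [S] and [R]. The terms for [i] split as
      [x0 y0 - x1 y1 = (x0 - x1) y1 + x0 (y0 - y1)], where the index tells
      whether [i] belongs to the base vertex, that is, into the terms of [dx y]
      and [x dy] in which [i] has been added to [S] or to [R]
      ([leibniz_term]). For this to be compatible with the two half-products,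
      the largest direction must lie in the same block before and after [i] is
      added, which holds unless [i] is itself the largest element of [T]. In
      that case all the terms vanish ([d_terms_larger]): in a rack, preferred
      squares identify the label of an edge with the label of its translate
      along a larger direction ([emap_larger]), so the two faces of a cube in
      its last direction are equal. *)

Set Implicit Arguments.
Unset Strict Implicit.
Unset Printing Implicit Defensive.

Import GRing.Theory Num.Theory.

Local Open Scope ring_scope.

(** * Increasing maps between ordinals *)

Lemma sorted_val_enum n (T : {set 'I_n}) : sorted ltn (map val (enum T)).
Proof.
have -> : enum T = filter (mem T) (enum 'I_n).
  by rewrite {1}/enum_mem -enumT.
rewrite sorted_map; apply: sorted_filter => [x y z|]; first exact: ltn_trans.
by rewrite -sorted_map val_enum_ord iota_ltn_sorted.
Qed.

Lemma incr_exists n (T : {set 'I_n}) p : #|T| = p ->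
  exists2 phi : 'I_p -> 'I_n,
    {homo phi : a b / (a < b)%N} & phi @: setT = T.
Proof.
move=> <-; exists (@enum_val _ (mem T)); last first.
  apply/setP => x; apply/imsetP/idP => [[a _ ->]|Tx]; first exact: enum_valP.
  by exists (enum_rank_in Tx x) => //; rewrite enum_rankK_in.
move=> a b ab; have x0 := enum_val a; rewrite !(enum_val_nth x0).
have lt_size (c : 'I_#|T|) : (c < size (enum T))%N by rewrite -cardE.
rewrite -!(nth_map x0 (val x0) val) //.
by apply: (sorted_ltn_nth ltn_trans _ (sorted_val_enum T));
   rewrite ?inE ?size_map.
Qed.

Lemma incr_mono n p (phi : 'I_p -> 'I_n) :
  {homo phi : a b / (a < b)%N} -> forall a b, (phi a < phi b)%N = (a < b)%N.
Proof.
move=> hphi a b; case: (ltngtP a b) => [/hphi //|/hphi ba|/val_inj->].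
  by rewrite ltnNge ltnW.
by rewrite ltnn.
Qed.

Lemma incr_image_inj n p (phi psi : 'I_p -> 'I_n) :
  {homo phi : a b / (a < b)%N} -> {homo psi : a b / (a < b)%N} ->
  phi @: setT = psi @: setT -> phi =1 psi.
Proof.
move=> hphi hpsi eqT a.
have srt (f : 'I_p -> 'I_n) : {homo f : a b / (a < b)%N} ->
    sorted ltn [seq val (f i) | i <- enum 'I_p].
  move=> hf; rewrite sorted_map.
  have: sorted (relpre val ltn) (enum 'I_p).
    by rewrite -sorted_map val_enum_ord iota_ltn_sorted.
  by apply: sub_sorted => x y; exact: hf.
have/eq_in_map/(_ a) : [seq val (phi i) | i <- enum 'I_p] =
          [seq val (psi i) | i <- enum 'I_p].
  apply: (irr_sorted_eq ltn_trans ltnn); try exact: srt.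
  move=> x; apply/mapP/mapP => -[i _ ->].
    have: phi i \in psi @: setT by rewrite -eqT imset_f.
    by case/imsetP => j _ ->; exists j; rewrite ?mem_enum.
  have: psi i \in phi @: setT by rewrite eqT imset_f.
  by case/imsetP => j _ ->; exists j; rewrite ?mem_enum.
by rewrite mem_enum => /(_ isT)/val_inj.
Qed.


(** * Faces of cubes in the nerve *)

Lemma nerve_ext (X : rack) n (F G : nerve X n) : emap F =1 emap G -> F = G.
Proof.
case: F G => [vF eF sF tF pF] [vG eG sG tG pG] /= /funext eFG.
have eV : vF = vG by apply/funext => v; case: (vF v); case: (vG v).
by rewrite {}eFG {}eV in sF tF pF sG tG pG *; congr TrunkMap.
Qed.

Lemma eq_emap (X : rack) n (F : nerve X n) (e e' : cube_edge n) :
  val e = val e' -> emap F e = emap F e'.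
Proof. by move=> /val_inj ->. Qed.

Section Subcube.
Variables (X : rack).

(** [subcube_of F T B G]: the cube [G] is the face of [F] spanned by the
    directions in [T] at the base vertex [B], its directions being numbered in
    increasing order. *)
Definition subcube_of p n (F : nerve X n) (T B : {set 'I_n})
    (G : nerve X p) : Prop :=
  exists (phi : 'I_p -> 'I_n) (phi_incr : {homo phi : a b / (a < b)%N})
    (phiB : forall a, phi a \notin B),
    phi @: setT = T /\ G = trunk_comp F (cube_map phi_incr phiB).

Lemma subcube_uniq p n (F : nerve X n) T B (G G' : nerve X p) :
  subcube_of F T B G -> subcube_of F T B G' -> G = G'.
Proof.
move=> [phi [incr [phiB [imT ->]]]] [psi [incr' [psiB [imT' ->]]]].
have e : phi =1 psi by apply: incr_image_inj; rewrite // imT imT'.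
apply: nerve_ext => c /=; apply: eq_emap => /=.
by rewrite /cube_map_vertex e (eq_imset _ e).
Qed.

Lemma subcube_card p n (F : nerve X n) T B (G : nerve X p) :
  subcube_of F T B G -> #|T| = p.
Proof.
move=> [phi [incr [phiB [<- _]]]].
by rewrite card_imset ?cardsT ?card_ord //; exact: incr_inj.
Qed.

Lemma subcube_exists p n (F : nerve X n) (T B : {set 'I_n}) :
  [disjoint T & B] -> #|T| = p -> exists G : nerve X p, subcube_of F T B G.
Proof.
move=> TB /incr_exists[phi incr imT].
have phiB a : phi a \notin B.
  by rewrite (disjointFr TB) // -imT imset_f.
by exists (trunk_comp F (cube_map incr phiB)), phi, incr, phiB.
Qed.

Lemma subcube_full n (F : nerve X n) : subcube_of F setT set0 F.
Proof.
have phiB (a : 'I_n) : id a \notin (set0 : {set 'I_n}) by rewrite inE.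
exists id, (fun _ _ ab => ab), phiB; rewrite imset_id; split=> //.
apply: nerve_ext => e /=; apply: eq_emap => /=.
by rewrite /cube_map_vertex set0U imset_id; case: (val e).
Qed.

Lemma subcube_comp p m n (F : nerve X n) (phi : 'I_m -> 'I_n) B incr phiB
    (psi : 'I_p -> 'I_m) (C : {set 'I_m}) incr' psiC :
  subcube_of F (phi @: (psi @: setT)) (B :|: phi @: C)
    (trunk_comp (trunk_comp F (@cube_map m n phi B incr phiB))
       (@cube_map p m psi C incr' psiC)).
Proof.
have incr2 : {homo phi \o psi : a b / (a < b)%N} by move=> a b /incr'/incr.
have disj a : (phi \o psi) a \notin B :|: phi @: C.
  by rewrite inE negb_or phiB /= mem_imset ?psiC //; exact: incr_inj.
exists (phi \o psi), incr2, disj; rewrite imset_comp; split=> //.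
apply: nerve_ext => e /=; apply: eq_emap => /=.
rewrite /cube_map_vertex /= (imset_comp phi psi) imsetU.
by rewrite setUA.
Qed.

(** The square axiom of the trunk of a rack says that the label of an edge does
    not change when the edge is moved along a larger direction. *)
Lemma emap_larger n (F : nerve X n) (e e' : cube_edge n) (l : 'I_n) :
  ((val e).2 < l)%N -> l \notin (val e).1 ->
  val e' = (l |: (val e).1, (val e).2) -> emap F e = emap F e'.
Proof.
case: e => -[A k] /= kA kl lA ee'.
have kl_neq : l != k by apply: contraTneq kl => ->; rewrite ltnn.
have lkA : l \notin k |: A by rewrite !inE negb_or kl_neq.
pose b : cube_edge n := exist _ (k |: A, l) lkA.
pose c : cube_edge n := exist _ (A, l) lA.
suff sq : @preferred (cube n) (exist _ (A, k) kA) b c e'.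
  by case: (preferred_emap F sq).
by exists A, k, l.
Qed.

Lemma subcube_larger p n (F : nerve X n) (T B : {set 'I_n}) (G : nerve X p)
    (l : 'I_n) :
  (forall t, t \in T -> t < l)%N -> l \notin B ->
  subcube_of F T B G -> subcube_of F T (l |: B) G.
Proof.
move=> Tl lB [phi [incr [phiB [imT ->]]]].
have lt_phi a : (phi a < l)%N by apply: Tl; rewrite -imT imset_f.
have disj a : phi a \notin l |: B.
  rewrite !inE negb_or phiB andbT; apply: contraTneq (lt_phi a) => ->.
  by rewrite ltnn.
exists phi, incr, disj; split=> //; apply: nerve_ext => e.
apply: (@emap_larger n F _ _ l); rewrite /= ?lt_phi //.
  rewrite inE negb_or lB; apply/imsetP => -[a _ la].
  by have := lt_phi a; rewrite -la ltnn.
by rewrite /cube_map_vertex setUA.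
Qed.

End Subcube.

(** * Signs of shuffles *)

(** The number of inversions between two sets of directions: the sign of the
    shuffle which lists [U] first and then [V] is [(-1) ^+ inversions U V]. *)
Definition inversions n (U V : {set 'I_n}) : nat :=
  (\sum_(u in U) \sum_(v in V) (v < u))%N.

(** One more than the largest element of [U], and 0 if [U] is empty. *)
Definition top n (U : {set 'I_n}) : nat := (\max_(u in U) u.+1)%N.

(** The sign of [s] relates the Vandermonde determinant of [0, ..., n-1] to
    that of [s 0, ..., s (n-1)]. The first is positive, and the inversions of
    [s] count the negative factors of the second. *)
Lemma odd_perm_inversions n (s : 'S_n) :
  odd_perm s = odd (\sum_(i < n) \sum_(j < n | (i < j)%N) (s j < s i))%N.
Proof.
apply: (@signr_inj int); rewrite signr_odd.
pose V := Vandermonde n (\row_(j < n) (j%:Z : int)).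
have : \det (col_perm s V) = (-1) ^+ s * \det V.
  by rewrite col_permE det_mulmx det_perm odd_permV mulrC.
have -> : col_perm s V = Vandermonde n (\row_(j < n) ((s j)%:Z : int)).
  by apply/matrixP => i j; rewrite !mxE.
rewrite !det_Vandermonde => eqV; apply/esym.
have sgV (t : 'S_n) : Num.sg (\prod_(i < n) \prod_(j < n | (i < j)%N)
      ((\row_(j < n) ((t j)%:Z : int)) 0 j -
       (\row_(j < n) ((t j)%:Z : int)) 0 i)) =
    (-1) ^+ (\sum_(i < n) \sum_(j < n | (i < j)%N) (t j < t i))%N.
  rewrite (big_morph _ (@sgrM _) (@sgr1 _)) expr_sum; apply: eq_bigr => i _.
  rewrite (big_morph _ (@sgrM _) (@sgr1 _)) expr_sum; apply: eq_bigr => j ij.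
  rewrite !mxE; case: (ltngtP (t j) (t i)) => [ji|ji|/val_inj/perm_inj ji].
  - by rewrite expr1 ltr0_sg // subr_lt0 ltz_nat.
  - by rewrite expr0 gtr0_sg // subr_gt0 ltz_nat.
  - by rewrite ji ltnn in ij.
have := congr1 Num.sg eqV; rewrite sgrM sgrX sgrN sgr1 sgV => ->.
rewrite -[RHS]mulr1; congr (_ * _); transitivity
  (Num.sg (\prod_(i < n) \prod_(j < n | (i < j)%N)
      ((\row_(j < n) (((1%g : 'S_n) j)%:Z : int)) 0 j -
       (\row_(j < n) (((1%g : 'S_n) j)%:Z : int)) 0 i))).
  congr Num.sg; apply: eq_bigr => i _; apply: eq_bigr => j _.
  by rewrite !mxE !perm1.
rewrite sgV big1 // => i _; rewrite big1 // => j ij.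
by rewrite !perm1 ltnNge ltnW.
Qed.

Lemma ltn_top n (U : {set 'I_n}) (u : 'I_n) : u \in U -> (u < top U)%N.
Proof. exact: (@leq_bigmax_cond _ (mem U) (fun v : 'I_n => v.+1)). Qed.

Lemma top_leq n (U : {set 'I_n}) m :
  (forall u, u \in U -> (u < m)%N) -> (top U <= m)%N.
Proof. by move=> Um; apply/bigmax_leqP. Qed.

Lemma top_ltP n (U V : {set 'I_n}) :
  reflect (exists2 u, u \in U & forall v, v \in V -> (v < u)%N)
    (top V < top U)%N.
Proof.
apply: (iffP idP) => [|[u uU uV]].
  rewrite {2}/top; have [->|[u0 u0U]] := set_0Vmem U.
    by rewrite big_set0.
  have U0 : (0 < #|U|)%N by apply/card_gt0P; exists u0.
  have [u uU ->] := eq_bigmax_cond (fun u : 'I_n => u.+1) U0.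
  rewrite ltnS => VU; exists u => // v /ltn_top vV.
  exact: leq_trans vV VU.
by apply: leq_trans (ltn_top uU); rewrite ltnS; exact: top_leq.
Qed.

Lemma topU n (U V : {set 'I_n}) : top (U :|: V) = maxn (top U) (top V).
Proof.
apply/eqP; rewrite eqn_leq geq_max; apply/and3P; split; apply: top_leq => i iU.
- by rewrite leq_max; case/setUP: iU => /ltn_top ->; rewrite ?orbT.
- by apply: ltn_top; rewrite inE iU.
- by apply: ltn_top; rewrite inE iU orbT.
Qed.

Lemma top1 n (i : 'I_n) : top [set i] = i.+1.
Proof. by rewrite /top big_set1. Qed.

Lemma sum_setU n (U V : {set 'I_n}) (h : 'I_n -> nat) : [disjoint U & V] ->
  (\sum_(u in U :|: V) h u = \sum_(u in U) h u + \sum_(u in V) h u)%N.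
Proof.
move=> UV; rewrite -bigU //=; apply: eq_bigl => u.
by rewrite in_setU.
Qed.

Lemma inversionsUl n (U V W : {set 'I_n}) : [disjoint U & V] ->
  inversions (U :|: V) W = (inversions U W + inversions V W)%N.
Proof. by move=> UV; rewrite /inversions sum_setU. Qed.

Lemma inversionsUr n (U V W : {set 'I_n}) : [disjoint V & W] ->
  inversions U (V :|: W) = (inversions U V + inversions U W)%N.
Proof.
move=> VW; rewrite /inversions -big_split /=; apply: eq_bigr => u _.
by rewrite sum_setU.
Qed.

Lemma inversions1l n (i : 'I_n) (V : {set 'I_n}) :
  inversions [set i] V = #|[set v in V | (v < i)%N]|.
Proof.
rewrite /inversions big_set1 -sum1_card; under [RHS]eq_bigl do rewrite inE.
by rewrite big_mkcondr.
Qed.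

Lemma inversions1r n (i : 'I_n) (U : {set 'I_n}) :
  inversions U [set i] = #|[set u in U | (i < u)%N]|.
Proof.
rewrite /inversions -sum1_card; under [RHS]eq_bigl do rewrite inE.
rewrite big_mkcondr; apply: eq_bigr => u _.
by rewrite big_set1.
Qed.

Lemma inversions_imset n p q (phi : 'I_p -> 'I_n) (psi : 'I_q -> 'I_n) :
  injective phi -> injective psi ->
  inversions (phi @: setT) (psi @: setT) = (\sum_a \sum_b (psi b < phi a))%N.
Proof.
move=> iphi ipsi.
rewrite /inversions big_imset /=; last by move=> ? ? _ _ /iphi.
apply: eq_big => [a|a _]; first by rewrite inE.
rewrite big_imset /=; last by move=> ? ? _ _ /ipsi.
by apply: eq_bigl => b; rewrite inE.
Qed.

Lemma inversions1U1 n (i : 'I_n) (S : {set 'I_n}) :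
  inversions [set i] (i |: S) = inversions [set i] S.
Proof.
rewrite !inversions1l; apply: eq_card => j; rewrite !inE.
by case: eqVneq => [->|]; rewrite //= ltnn andbF.
Qed.

Lemma inversions1C n (i : 'I_n) (S : {set 'I_n}) : i \notin S ->
  (inversions [set i] S + inversions S [set i])%N = #|S|.
Proof.
move=> iS; rewrite inversions1l inversions1r.
rewrite -(cardsID [set v : 'I_n | (v < i)%N] S).
congr (_ + _)%N; apply: eq_card => j; rewrite !inE //.
case: (boolP (j \in S)) => jS; rewrite ?andbF //= andbT.
case: ltngtP => // /val_inj ij; by rewrite ij jS in iS.
Qed.

(** * Shuffles *)

Lemma sign_shuffle p q (s : shuffle p q) :
  odd_perm (val s) =
  odd (\sum_(a < p) \sum_(b < q)
         (val s (rshift p b) < val s (lshift q a)))%N.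
Proof.
have incrl := shuffle_incrl s; have incrr := shuffle_incrr s.
rewrite odd_perm_inversions big_split_ord /= -[in RHS](addn0 (\sum_a _)%N).
congr (odd (_ + _)%N); last first.
  rewrite big1 // => b _; rewrite big_split_ord /=.
  rewrite big_pred0 => [|a]; last first.
    by rewrite /= ltnNge (leq_trans (ltnW (ltn_ord a))) ?leq_addr.
  rewrite add0n big1 // => c bc.
  by rewrite ltnNge ltnW // incrr // -(ltn_add2l p).
apply: eq_bigr => a _; rewrite big_split_ord /= big1 => [|c ac].
  by rewrite add0n; apply: eq_bigl => b; rewrite ltn_addr.
by rewrite ltnNge ltnW // incrl.
Qed.

Lemma perm_max n (s : 'S_n) (i : 'I_n) :
  ((s i).+1 == n) = [forall j, (s j <= s i)%N].
Proof.
apply/idP/forallP => [/eqP e j|H]; first by rewrite -ltnS e.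
case: n s i H => [|n] s i H; first by case: i {H}.
rewrite eqSS eqn_leq -ltnS ltn_ord /=.
by have := H (s^-1%g ord_max); rewrite permKV.
Qed.

(** The largest of the [p + q] directions exists and lies in the left block. *)
Definition max_left p q (s : shuffle p q) : bool :=
  [exists a : 'I_p, [forall b : 'I_q,
     (val s (rshift p b) < val s (lshift q a))%N]].

Lemma shuffle_left0 p (s : shuffle p 0) : val s = 1%g.
Proof.
apply/permP => i; rewrite perm1; have [a ->|[]//] := split_ordP i.
apply: (@incr_image_inj _ _ (fun a => val s (lshift 0 a)) (lshift 0)) => //.
  exact: shuffle_incrl.
have full (h : 'I_p -> 'I_(p + 0)) : injective h -> h @: setT = setT.
  move=> ih; apply/eqP; rewrite eqEcard subsetT card_imset //.
  by rewrite !cardsT !card_ord addn0 /=.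
rewrite !full // => [b c /lshift_inj//|b c /perm_inj/lshift_inj //].
Qed.

Lemma shuffle_right0 q (s : shuffle 0 q) : val s = 1%g.
Proof.
apply/permP => i; rewrite perm1; have [[]//|a ->] := split_ordP i.
apply: (@incr_image_inj _ _ (fun a => val s (rshift 0 a)) (@rshift 0 q)) => //.
  exact: shuffle_incrr.
have full (h : 'I_q -> 'I_(0 + q)) : injective h -> h @: setT = setT.
  move=> ih; apply/eqP; rewrite eqEcard subsetT card_imset //.
  by rewrite !cardsT !card_ord add0n leqnn.
rewrite !full // => [b c /rshift_inj//|b c /perm_inj/rshift_inj //].
Qed.

Lemma last_in_leftE p q (s : shuffle p q) : last_in_left (val s) = max_left s.
Proof.
rewrite /last_in_left; case: p s => [|p] s /=.
  by apply/esym/negbTE/existsP => -[[]].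
case: q s => [|q] s /=.
  rewrite shuffle_left0 eqxx; apply/esym/existsP.
  by exists ord0; apply/forallP => -[].
have incrl := shuffle_incrl s.
apply/forallP/existsP => [H|[a /forallP Ha] i].
  exists ord_max; apply/forallP => b.
  have := H (lshift q.+1 ord_max); rewrite /= eqxx perm_max => /forallP.
  move=> /(_ (rshift p.+1 b)); rewrite leq_eqVlt => /orP[|//].
  by rewrite (inj_eq val_inj) (inj_eq perm_inj) eq_rlshift.
apply/implyP => /eqP ip; rewrite perm_max; apply/forallP => j.
have -> : i = lshift q.+1 ord_max by apply: val_inj; case: ip.
have le_last c : (val s (lshift q.+1 c) <= val s (lshift q.+1 ord_max))%N.
  by rewrite leqNgt (incr_mono incrl) -leqNgt -ltnS.
have [c ->|b ->] := split_ordP j; first exact: le_last.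
exact: leq_trans (ltnW (Ha b)) (le_last a).
Qed.

Lemma last_in_rightE p q (s : shuffle p q) :
  last_in_right (val s) = ~~ max_left s.
Proof.
rewrite /last_in_right; case: p s => [|p] s /=.
  by rewrite shuffle_right0 eqxx; apply/esym/existsPn => -[].
case: q s => [|q] s /=.
  by apply/esym/negbF/existsP; exists ord0; apply/forallP => -[].
have incrr := shuffle_incrr s.
apply/forallP/existsPn => [H a|H i].
  apply/negP => /forallP/(_ ord_max).
  have last_b : (rshift p.+1 (ord_max : 'I_q.+1)).+1 == (p.+1 + q.+1)%N.
    by rewrite /= addnS.
  have := implyP (H _) last_b; rewrite perm_max => /forallP.
  by move=> /(_ (lshift q.+1 a)); rewrite leqNgt => /negPf->.
apply/implyP => /eqP ip; rewrite perm_max; apply/forallP => j.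
have -> : i = rshift p.+1 ord_max.
  by apply/val_inj/eqP; rewrite /= -eqSS ip -addnS.
have le_last c : (val s (rshift p.+1 c) <= val s (rshift p.+1 ord_max))%N.
  by rewrite leqNgt (incr_mono incrr) -leqNgt -ltnS.
have [a ->|b ->] := split_ordP j; last exact: le_last.
have /forallPn[b] : ~~ [forall b, (val s (rshift p.+1 b)
                                   < val s (lshift q.+1 a))%N].
  exact: H.
by rewrite -leqNgt => /leq_trans -> //.
Qed.

(** Every [p]-subset of the [p + q] directions is the left block of a
    shuffle. *)
Lemma shuffle_of_set p q (S : {set 'I_(p + q)}) : #|S| = p ->
  exists s : shuffle p q, shuffle_base s = S.
Proof.
move=> cS; have [al incr_al im_al] := incr_exists cS.
have cS' : #|~: S| = q by apply: (@addnI p); rewrite -{1}cS cardsC card_ord.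
have [be incr_be im_be] := incr_exists cS'.
pose h i := match fintype.split i with inl a => al a | inr b => be b end.
have alS a : al a \in S by rewrite -im_al imset_f.
have beS b : be b \notin S by rewrite -in_setC -im_be imset_f.
have hl a : h (lshift q a) = al a.
  by rewrite /h -[lshift q a]/(unsplit (inl a)) unsplitK.
have hr b : h (rshift p b) = be b.
  by rewrite /h -[rshift p b]/(unsplit (inr b)) unsplitK.
have inj_h : injective h.
  move=> i j; have [a ->|a ->] := split_ordP i;
  have [b ->|b ->] := split_ordP j; rewrite ?hl ?hr.
  - by move/(incr_inj incr_al)->.
  - by move=> e; have := alS a; rewrite e (negPf (beS b)).
  - by move=> e; have := alS b; rewrite -e (negPf (beS a)).
  - by move/(incr_inj incr_be)->.
have sh : is_shuffle (perm inj_h).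
  by apply/andP; split; apply/forallP => a; apply/forallP => b; apply/implyP;
     rewrite !permE ?hl ?hr; [exact: incr_al | exact: incr_be].
exists (exist _ (perm inj_h) sh); rewrite -im_al /shuffle_base /=.
apply/setP => i; apply/imsetP/imsetP => -[a _ ->]; exists a => //;
by rewrite permE hl.
Qed.

Lemma imset_setT (aT rT : finType) (f : aT -> rT) :
  f @: [set: aT] = [set f a | a : aT].
Proof. by apply/setP => x; apply/imsetP/imsetP => -[a _ ->]; exists a. Qed.

Lemma shuffle_baseC p q (s : shuffle p q) :
  ~: shuffle_base s = [set val s (rshift p b) | b : 'I_q].
Proof.
apply/setP => i; rewrite inE; apply/idP/imsetP => [|[b _ ->]]; last first.
  exact: shuffle_notin_base.
rewrite -(permKV (val s) i); have [a ->|b -> _] := split_ordP ((val s)^-1 i)%g.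
  by rewrite imset_f.
by exists b.
Qed.

Lemma shuffle_base_inj p q : injective (@shuffle_base p q).
Proof.
move=> s t est; have : ~: shuffle_base s = ~: shuffle_base t by rewrite est.
rewrite !shuffle_baseC => estC.
apply/val_inj/permP => i; have [a ->|b ->] := split_ordP i.
  apply: (@incr_image_inj _ _ (fun a => val s (lshift q a))
                              (fun a => val t (lshift q a))).
  - exact: shuffle_incrl.
  - exact: shuffle_incrl.
  - by rewrite !imset_setT.
apply: (@incr_image_inj _ _ (fun a => val s (rshift p a))
                            (fun a => val t (rshift p a))).
- exact: shuffle_incrr.
- exact: shuffle_incrr.
- by rewrite !imset_setT.
Qed.

(** * Cochains evaluated on subcubes *)

Section CochainAt.
Variables (k : comPzRingType) (X : rack) (A : lmodType k).

(** The value of [f] on the face of [F] spanned by the directions in [T] at the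
    base vertex [B]; it is 0 when [F] has no such face of the degree of [f], so
    that it makes sense for sets [T] of any cardinality. *)
Definition cochain_at p (f : cochain X A p) n (F : nerve X n)
    (T B : {set 'I_n}) : A :=
  if pselect (exists G, @subcube_of X p n F T B G) is left ex
  then f (projT1 (cid ex)) else 0.

Lemma at_subcube p (f : cochain X A p) n (F : nerve X n) (T B : {set 'I_n}) G :
  subcube_of F T B G -> cochain_at f F T B = f G.
Proof.
rewrite /cochain_at; case: pselect => [ex|nex] FG; last by case: nex; exists G.
by case: cid => G' /= FG'; rewrite (subcube_uniq FG FG').
Qed.

Lemma at_card p (f : cochain X A p) n (F : nerve X n) (T B : {set 'I_n}) :
  #|T| <> p -> cochain_at f F T B = 0.
Proof.
rewrite /cochain_at; case: pselect => // ex []; case: ex => G.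
exact: subcube_card.
Qed.

Lemma at_full n (f : cochain X A n) (F : nerve X n) :
  cochain_at f F setT set0 = f F.
Proof. exact: at_subcube (subcube_full F). Qed.

Lemma cochain_atP p (f g : cochain X A p) :
  (forall n (F : nerve X n) (T B : {set 'I_n}), [disjoint T & B] ->
     cochain_at f F T B = cochain_at g F T B) -> f = g.
Proof.
move=> fg; apply/funext => F; rewrite -!at_full; apply: fg.
by rewrite -setI_eq0 setI0.
Qed.

Lemma at_deg_cast m p (e : m = p) (f : cochain X A m) n
    (F : nerve X n) (T B : {set 'I_n}) :
  cochain_at (deg_cast (D := cochain X A) e f) F T B = cochain_at f F T B.
Proof. by case: p / e. Qed.

Lemma at0 p n (F : nerve X n) (T B : {set 'I_n}) :
  cochain_at (0 : cochain X A p) F T B = 0.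
Proof. by rewrite /cochain_at; case: pselect. Qed.

Lemma atD p (f g : cochain X A p) n (F : nerve X n) (T B : {set 'I_n}) :
  cochain_at (f + g) F T B = cochain_at f F T B + cochain_at g F T B.
Proof. by rewrite /cochain_at; case: pselect => // _; rewrite addr0. Qed.

Lemma atZ p a (f : cochain X A p) n (F : nerve X n) (T B : {set 'I_n}) :
  cochain_at (a *: f) F T B = a *: cochain_at f F T B.
Proof. by rewrite /cochain_at; case: pselect => // _; rewrite scaler0. Qed.

(** Moving the base vertex along a direction larger than those of the face does
    not change the face. *)
Lemma at_larger p (f : cochain X A p) n (F : nerve X n) (T B : {set 'I_n})
    (l : 'I_n) :
  (forall t, t \in T -> (t < l)%N) -> [disjoint T & B] -> l \notin B ->
  cochain_at f F T (l |: B) = cochain_at f F T B.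
Proof.
move=> Tl TB lB; have [cT|cT] := eqVneq #|T| p; last first.
  by rewrite !at_card //; apply/eqP.
have [G FG] := subcube_exists F TB cT.
by rewrite (at_subcube f FG) (at_subcube f (subcube_larger Tl lB FG)).
Qed.

(** The direction [i] of [T] has index [inversions [set i] T], counted from 0,
    among the directions of the face. *)
Lemma at_d p (f : cochain X A p) n (F : nerve X n) (T B : {set 'I_n}) :
  [disjoint T & B] ->
  cochain_at (cochain_d f) F T B =
  \sum_(i in T) (-1) ^+ (inversions [set i] T).+1 *:
     (cochain_at f F (T :\ i) B - cochain_at f F (T :\ i) (i |: B)).
Proof.
move=> TB; have [cT|cT] := eqVneq #|T| p.+1; last first.
  rewrite at_card; last exact/eqP.
  rewrite big1 // => i iT; rewrite !at_card ?subrr ?scaler0 //;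
  by move: cT; rewrite (cardsD1 i) iT => /eqP cT cTi; apply: cT; rewrite cTi.
have [phi incr imT] := incr_exists cT.
have phiB a : phi a \notin B by rewrite (disjointFr TB) // -imT imset_f.
have FG : subcube_of F T B (trunk_comp F (cube_map incr phiB)).
  by exists phi, incr, phiB.
have iphi := incr_inj incr.
rewrite (at_subcube _ FG) /cochain_d fct_sumE -{1}imT big_imset /=; last first.
  by move=> ? ? _ _ /iphi.
apply: eq_big => [i|i _]; first by rewrite inE.
have lift_im : phi @: (lift i @: setT) = T :\ phi i.
  have -> : lift i @: setT = setT :\ i.
    apply/setP => j; rewrite !inE andbT; apply/imsetP/idP => [[a _ ->]|].
      by rewrite eq_sym neq_lift.
    by rewrite eq_sym => /unlift_some[a -> _]; exists a.
  rewrite -imT; apply/setP => j; rewrite !inE.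
  apply/imsetP/andP => [[a]|[ji /imsetP[a _ ja]]].
    by rewrite !inE andbT => ai ->; rewrite (inj_eq iphi) ai imset_f.
  exists a => //; rewrite !inE andbT; apply: contraNneq ji => ai.
  by rewrite ja ai.
have sub eps := subcube_comp F (B := B) incr phiB (psi := lift i)
  (C := face_base i eps) (@lift_incr p i) (lift_face_base i eps).
have := sub false; have := sub true; rewrite lift_im /= imset_set1 imset0 setU0.
rewrite [B :|: _]setUC => F1 F0; rewrite (at_subcube f F0) (at_subcube f F1).
congr ((-1) ^+ _.+1 *: _).
rewrite /inversions big_set1 -imT big_imset /=; last by move=> ? ? _ _ /iphi.
under eq_bigr => a _ do rewrite (incr_mono incr).
have /(_ 0%N addn) := big_ord_widen p.+1 (fun=> 1%N) (ltnW (ltn_ord i)).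
rewrite big_const_ord iter_addn_0 mul1n => {1}->; rewrite big_mkcond /=.
by apply: eq_bigl => a; rewrite inE.
Qed.

End CochainAt.

(** * Bilinear products *)

Section Bilinear.
Variables (k : comPzRingType) (A : lmodType k).
Variables (mu : A -> A -> A) (mu_bilinear : is_bilinear mu).

Lemma mu0l x : mu 0 x = 0.
Proof.
have := mu_bilinear.1 x 1 0 0; rewrite /= !scale1r addr0 => mu00.
by apply: (@addrI _ (mu 0 x)); rewrite addr0 -mu00.
Qed.

Lemma mu0r x : mu x 0 = 0.
Proof.
have := mu_bilinear.2 x 1 0 0; rewrite /= !scale1r addr0 => mu00.
by apply: (@addrI _ (mu x 0)); rewrite addr0 -mu00.
Qed.

Lemma muDl x y z : mu (x + y) z = mu x z + mu y z.
Proof. by have := mu_bilinear.1 z 1 x y; rewrite /= !scale1r. Qed.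

Lemma muDr x y z : mu x (y + z) = mu x y + mu x z.
Proof. by have := mu_bilinear.2 x 1 y z; rewrite /= !scale1r. Qed.

Lemma muZl a x y : mu (a *: x) y = a *: mu x y.
Proof.
by have := mu_bilinear.1 y a x 0; rewrite /= !addr0 mu0l addr0.
Qed.

Lemma muZr a x y : mu x (a *: y) = a *: mu x y.
Proof.
by have := mu_bilinear.2 x a y 0; rewrite /= !addr0 mu0r addr0.
Qed.

Lemma muBl x y z : mu (x - y) z = mu x z - mu y z.
Proof. by rewrite muDl -scaleN1r muZl scaleN1r. Qed.

Lemma muBr x y z : mu x (y - z) = mu x y - mu x z.
Proof. by rewrite muDr -scaleN1r muZr scaleN1r. Qed.

Lemma mu_suml (I : finType) (P : pred I) (F : I -> A) y :
  mu (\sum_(i | P i) F i) y = \sum_(i | P i) mu (F i) y.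
Proof. exact: (big_morph (mu^~ y) (fun _ _ => muDl _ _ _) (mu0l y)). Qed.

Lemma mu_sumr (I : finType) (P : pred I) (F : I -> A) x :
  mu x (\sum_(i | P i) F i) = \sum_(i | P i) mu x (F i).
Proof. exact: (big_morph (mu x) (fun _ _ => muDr _ _ _) (mu0r x)). Qed.

End Bilinear.

(** * Half-products on subcubes *)

Section Products.
Variables (k : comPzRingType) (X : rack) (A : lmodType k).
Variables (mu : A -> A -> A) (mu_bilinear : is_bilinear mu).

(** The left half-product if [b] is true, and the right one otherwise. *)
Definition half_prod (b : bool) p q (f : cochain X A p) (g : cochain X A q) :
    cochain X A (p + q) :=
  if b then prec_prod mu f g else succ_prod mu f g.

Lemma half_prodE b p q (f : cochain X A p) (g : cochain X A q) F :
  half_prod b f g F =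
  \sum_(s : shuffle p q | max_left s == b)
     (-1) ^+ (val s) *: mu (f (rho s F).1) (g (rho s F).2).
Proof.
rewrite /half_prod; case: b; rewrite /prec_prod /succ_prod fct_sumE;
apply: eq_bigl => s; rewrite ?last_in_leftE ?last_in_rightE ?eqb_id //.
Qed.

Lemma half_prod_bilinear b p q : is_bilinear (@half_prod b p q).
Proof.
split=> h a f g; apply/funext => F.
  rewrite -[RHS]/(a *: half_prod b f h F + half_prod b g h F).
  rewrite !half_prodE scaler_sumr -big_split /=; apply: eq_bigr => s _.
  by rewrite (muDl mu_bilinear) (muZl mu_bilinear) scalerDr !scalerA mulrC.
rewrite -[RHS]/(a *: half_prod b h f F + half_prod b h g F).
rewrite !half_prodE scaler_sumr -big_split /=; apply: eq_bigr => s _.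
by rewrite (muDr mu_bilinear) (muZr mu_bilinear) scalerDr !scalerA mulrC.
Qed.

(** The blocks of a shuffle of the directions of a face of an [n]-cube, seen as
    directions of the [n]-cube. *)
Section ShuffleImage.
Variables (p q n : nat) (phi : 'I_(p + q) -> 'I_n).
Hypothesis phi_incr : {homo phi : a b / (a < b)%N}.
Variable s : shuffle p q.

Lemma shuffle_imageE :
  phi @: shuffle_base s = (fun a => phi (val s (lshift q a))) @: setT.
Proof.
by rewrite (imset_comp phi (fun a => val s (lshift q a))) imset_setT.
Qed.

Lemma shuffle_imageCE :
  phi @: (~: shuffle_base s) = (fun b => phi (val s (rshift p b))) @: setT.
Proof.
rewrite shuffle_baseC.
by rewrite (imset_comp phi (fun b => val s (rshift p b))) imset_setT.
Qed.

Lemma inversions_shuffle :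
  (-1) ^+ inversions (phi @: shuffle_base s) (phi @: (~: shuffle_base s)) =
  (-1) ^+ (val s) :> k.
Proof.
have iphi := incr_inj phi_incr.
rewrite -[LHS]signr_odd shuffle_imageE shuffle_imageCE sign_shuffle.
rewrite inversions_imset.
- congr (_ ^+ (odd _)); apply: eq_bigr => a _; apply: eq_bigr => b _.
  by rewrite (incr_mono phi_incr).
- by move=> a b /iphi/perm_inj/lshift_inj.
- by move=> a b /iphi/perm_inj/rshift_inj.
Qed.

Lemma max_left_image :
  (top (phi @: (~: shuffle_base s)) < top (phi @: shuffle_base s))%N =
  max_left s.
Proof.
rewrite shuffle_imageE shuffle_imageCE.
apply/top_ltP/existsP => [[_ /imsetP[a _ ->] H]|[a /forallP H]].
  exists a; apply/forallP => b; rewrite -(incr_mono phi_incr).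
  by apply: H; rewrite imset_f.
exists (phi (val s (lshift q a))); first by rewrite imset_f.
by move=> _ /imsetP[b _ ->]; rewrite (incr_mono phi_incr).
Qed.

End ShuffleImage.

(** The shuffles correspond to the subsets [S] of [T] of cardinality [p]; the
    other subsets contribute 0. *)
Lemma at_half b p q (f : cochain X A p) (g : cochain X A q) n (F : nerve X n)
    (T B : {set 'I_n}) : [disjoint T & B] ->
  cochain_at (half_prod b f g) F T B =
  \sum_(S : {set 'I_n} | (S \subset T) && ((top (T :\: S) < top S)%N == b))
     (-1) ^+ inversions S (T :\: S) *:
     mu (cochain_at f F S B) (cochain_at g F (T :\: S) (S :|: B)).
Proof.
move=> TB; have [cT|cT] := eqVneq #|T| (p + q)%N; last first.
  rewrite at_card; last exact/eqP.
  rewrite big1 // => S /andP[ST _]; move: cT; rewrite -(cardsID S T).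
  rewrite (setIidPr ST); have [->|/eqP cS] := eqVneq #|S| p; last first.
    by rewrite (at_card f _ _ cS) (mu0l mu_bilinear) scaler0.
  rewrite eqn_add2l => /eqP cTS.
  by rewrite (at_card g _ _ cTS) (mu0r mu_bilinear) scaler0.
have [phi incr imT] := incr_exists cT.
have phiB a : phi a \notin B by rewrite (disjointFr TB) // -imT imset_f.
set G := trunk_comp F (cube_map incr phiB).
have FG : subcube_of F T B G by exists phi, incr, phiB.
have iphi := incr_inj incr.
have imC (S : {set 'I_(p + q)}) : T :\: (phi @: S) = phi @: (~: S).
  apply/setP => j; rewrite -imT !inE; apply/andP/imsetP.
    case=> jS /imsetP[a _ ja]; exists a => //; rewrite inE.
    by apply: contra jS => aS; rewrite ja imset_f.
  by case=> a; rewrite inE => aS ->; rewrite mem_imset // aS imset_f.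
rewrite (at_subcube _ FG) half_prodE.
rewrite [RHS](bigID (fun S : {set 'I_n} => #|S| == p)) /=.
rewrite [X in _ = _ + X]big1; last first.
  move=> S /andP[_ /eqP cS].
  by rewrite (at_card f _ _ cS) (mu0l mu_bilinear) scaler0.
rewrite addr0.
pose h (s : shuffle p q) := phi @: shuffle_base s.
have card_base (s : shuffle p q) : #|shuffle_base s| = p.
  by rewrite card_imset ?card_ord // => a c /perm_inj/lshift_inj.
have eqh (S : {set 'I_n}) :
    (S \in [set h s | s : shuffle p q & max_left s == b]) =
    (S \subset T) && ((top (T :\: S) < top S)%N == b) && (#|S| == p).
  apply/imsetP/andP.
    case=> s; rewrite inE => sb ->.
    rewrite /h imC max_left_image // sb card_imset // card_base eqxx.
    by rewrite -imT imsetS ?subsetT.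
  case=> /andP[ST Sb] /eqP cS.
  have imS : phi @: (phi @^-1: S) = S.
    apply/setP => j; apply/imsetP/idP => [[a]|jS]; first by rewrite inE => ? ->.
    have := subsetP ST _ jS; rewrite -imT => /imsetP[a _ ja].
    by exists a; rewrite // inE -ja.
  have [|s sS] := @shuffle_of_set p q (phi @^-1: S).
    by have := card_imset (mem (phi @^-1: S)) iphi; rewrite imS cS.
  exists s; last by rewrite /h sS imS.
  by rewrite inE -(max_left_image incr) -imC sS imS.
rewrite -(eq_bigl _ _ eqh) big_imset /=; last first.
  by move=> s t _ _ /(imset_inj iphi)/shuffle_base_inj.
apply: eq_big => [s|s _]; first by rewrite inE.
rewrite /h imC inversions_shuffle //; congr (_ *: mu _ _).
  have := subcube_comp F (B := B) incr phiB (shuffle_incrl s)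
    (@shuffle_notin0 p q s).
  by rewrite imset_setT imset0 setU0 => /(at_subcube f).
have := subcube_comp F (B := B) incr phiB (shuffle_incrr s)
  (@shuffle_notin_base p q s).
by rewrite imset_setT -shuffle_baseC setUC => /(at_subcube g).
Qed.

End Products.

(** * Sums over subsets *)

Lemma disjointU1r n (T B : {set 'I_n}) i :
  [disjoint T & B] -> i \notin T -> [disjoint T & i |: B].
Proof.
rewrite -!setI_eq0 setIUr setU_eq0 => -> iT.
by rewrite andbT setI_eq0 disjoint_sym disjoints1.
Qed.

Lemma disjoint_setDU n (T B S : {set 'I_n}) :
  [disjoint T & B] -> [disjoint T :\: S & S :|: B].
Proof.
move=> TB; rewrite -setI_eq0 setIUr setIDAC setDIl setDv setI0 set0U.
by rewrite setIDAC (disjoint_setI0 TB) set0D.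
Qed.

Section SubsetSums.
Variables (n : nat) (M : nmodType).
Implicit Types (S T U V P : {set 'I_n}) (i : 'I_n).

(** Pairs [U \subset P] as pairs of disjoint sets [U] and [V], with
    [P = U :|: V]. *)
Lemma sum_nested T (C : pred {set 'I_n}) (D : {set 'I_n} -> pred {set 'I_n})
    (H : {set 'I_n} -> {set 'I_n} -> M) :
  \sum_(P : {set 'I_n} | (P \subset T) && C P)
    \sum_(U : {set 'I_n} | (U \subset P) && D P U) H P U =
  \sum_(U : {set 'I_n} | U \subset T)
    \sum_(V : {set 'I_n} | (V \subset T :\: U) &&
       (C (U :|: V) && D (U :|: V) U)) H (U :|: V) U.
Proof.
rewrite (exchange_big_dep (fun U : {set 'I_n} => U \subset T)) /=; last first.
  by move=> P U /andP[PT _] /andP[UP _]; exact: subset_trans PT.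
apply: eq_bigr => U UT.
rewrite (reindex_onto (fun V : {set 'I_n} => U :|: V)
                      (fun P : {set 'I_n} => P :\: U)) /=; last first.
  move=> P /andP[_ /andP[UP _]]; apply/setP => j; rewrite !inE.
  by case: (boolP (j \in U)) => //= /(subsetP UP).
apply: eq_bigl => V.
rewrite subUset UT subsetUl /= subsetD -setI_eq0 setDUl setDv set0U.
have -> : (V :\: U == V) = (V :&: U == set0).
  apply/eqP/eqP => [<-|VU]; last by rewrite -[RHS](setID V U) VU set0U.
  by apply/setP => j; rewrite !inE; case: (j \in U); rewrite ?andbF.
by case: (V \subset T); case: (C _); case: (D _ _); case: (_ == _).
Qed.

Lemma sum_cond (P C : pred {set 'I_n}) (Q D : {set 'I_n} -> pred {set 'I_n})
    (H : {set 'I_n} -> {set 'I_n} -> M) :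
  \sum_(U : {set 'I_n} | P U && C U)
    \sum_(V : {set 'I_n} | Q U V && D U V) H U V =
  \sum_(U : {set 'I_n} | P U)
    \sum_(V : {set 'I_n} | Q U V && (C U && D U V)) H U V.
Proof.
rewrite big_mkcondr; apply: eq_bigr => U _; case: (C U) => //=.
by rewrite big_pred0 // => V; rewrite andbF.
Qed.

(** The distinguished element [i] of [S] is removed from [S]. *)
Lemma sum_first T (C : pred {set 'I_n}) (H : {set 'I_n} -> 'I_n -> M) :
  \sum_(S : {set 'I_n} | (S \subset T) && C S) \sum_(i in S) H S i =
  \sum_(i in T)
    \sum_(S : {set 'I_n} | (S \subset T :\ i) && C (i |: S)) H (i |: S) i.
Proof.
rewrite (exchange_big_dep (mem T)) /=; last first.
  by move=> S i /andP[ST _] /(subsetP ST).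
apply: eq_bigr => i iT.
rewrite (reindex_onto (fun S : {set 'I_n} => i |: S)
                      (fun S : {set 'I_n} => S :\ i)) /=; last first.
  by move=> S /andP[_]; exact: setD1K.
apply: eq_bigl => S; rewrite subUset sub1set iT /= setU11 andbT subsetD1.
have -> : ((i |: S) :\ i == S) = (i \notin S).
  by apply/eqP/idP => [<-|/setU1K //]; rewrite setD11.
by rewrite andbAC.
Qed.

(** The distinguished element [i] is outside [S]. *)
Lemma sum_second T (C : pred {set 'I_n}) (H : {set 'I_n} -> 'I_n -> M) :
  \sum_(S : {set 'I_n} | (S \subset T) && C S) \sum_(i in T :\: S) H S i =
  \sum_(i in T) \sum_(S : {set 'I_n} | (S \subset T :\ i) && C S) H S i.
Proof.
rewrite (exchange_big_dep (mem T)) /=; last first.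
  by move=> S i _; rewrite inE => /andP[].
apply: eq_bigr => i iT; apply: eq_bigl => S.
by rewrite inE iT andbT subsetD1 andbAC.
Qed.

End SubsetSums.

(** * Associativity of the half-products *)

Section Triple.
Variables (k : comPzRingType) (X : rack) (A : lmodType k).
Variables (mu : A -> A -> A) (mu_bilinear : is_bilinear mu).
Hypothesis mu_assoc : associative mu.
Variables (p q r : nat).
Variables (x : cochain X A p) (y : cochain X A q) (z : cochain X A r).
Variables (n : nat) (F : nerve X n) (T B : {set 'I_n}).
Hypothesis TB : [disjoint T & B].

(** The contribution to the triple products of the partition of [T] into [U],
    [V] and the rest. *)
Definition triple_term (U V : {set 'I_n}) : A :=
  let W := T :\: U :\: V in
  (-1) ^+ (inversions U V + inversions U W + inversions V W) *:
  mu (mu (cochain_at x F U B) (cochain_at y F V (U :|: B)))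
     (cochain_at z F W (U :|: V :|: B)).

Lemma at_half_left b c :
  cochain_at (half_prod mu c (half_prod mu b x y) z) F T B =
  \sum_(U : {set 'I_n} | U \subset T)
   \sum_(V : {set 'I_n} | (V \subset T :\: U) &&
     (((top (T :\: U :\: V) < maxn (top U) (top V))%N == c) &&
      ((top V < top U)%N == b))) triple_term U V.
Proof.
rewrite (at_half mu_bilinear) //.
transitivity (
  \sum_(P : {set 'I_n} | (P \subset T) && ((top (T :\: P) < top P)%N == c))
  \sum_(U : {set 'I_n} | (U \subset P) && ((top (P :\: U) < top U)%N == b))
  (-1) ^+ (inversions P (T :\: P) + inversions U (P :\: U)) *:
  mu (mu (cochain_at x F U B) (cochain_at y F (P :\: U) (U :|: B)))
     (cochain_at z F (T :\: P) (P :|: B))).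
  apply: eq_bigr => P /andP[PT _].
  have PB : [disjoint P & B] by apply: disjointWl TB.
  rewrite (at_half mu_bilinear) // (mu_suml mu_bilinear) scaler_sumr.
  apply: eq_bigr => U _.
  by rewrite (muZl mu_bilinear) scalerA -exprD.
rewrite sum_nested; apply: eq_bigr => U UT.
have UVU (V : {set 'I_n}) : V \subset T :\: U -> (U :|: V) :\: U = V.
  rewrite subsetD => /andP[_ VU]; rewrite setDUl setDv set0U.
  by apply/setDidPl.
apply: eq_big => [V|V /andP[VT _]].
  case: (boolP (V \subset _)) => //= VT.
  by rewrite UVU // topU setDDl.
rewrite UVU // /triple_term -setDDl.
have UV : [disjoint U & V].
  by move: VT; rewrite subsetD disjoint_sym => /andP[].
by rewrite inversionsUl // addnC addnA.
Qed.

Lemma at_half_right b c :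
  cochain_at (half_prod mu b x (half_prod mu c y z)) F T B =
  \sum_(U : {set 'I_n} | U \subset T)
   \sum_(V : {set 'I_n} | (V \subset T :\: U) &&
     (((maxn (top V) (top (T :\: U :\: V)) < top U)%N == b) &&
      ((top (T :\: U :\: V) < top V)%N == c))) triple_term U V.
Proof.
rewrite (at_half mu_bilinear) //.
transitivity (
  \sum_(U : {set 'I_n} | (U \subset T) && ((top (T :\: U) < top U)%N == b))
  \sum_(V : {set 'I_n} | (V \subset T :\: U) &&
    ((top (T :\: U :\: V) < top V)%N == c))
  (-1) ^+ (inversions U (T :\: U) + inversions V (T :\: U :\: V)) *:
  mu (mu (cochain_at x F U B) (cochain_at y F V (U :|: B)))
     (cochain_at z F (T :\: U :\: V) (U :|: V :|: B))).
  apply: eq_bigr => U /andP[UT _].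
  have TUB : [disjoint T :\: U & U :|: B] by exact: disjoint_setDU.
  rewrite (at_half mu_bilinear) // (mu_sumr mu_bilinear) scaler_sumr.
  apply: eq_bigr => V _.
  rewrite (muZr mu_bilinear) scalerA -exprD mu_assoc.
  by rewrite [V :|: (U :|: B)]setUCA setUA.
rewrite sum_cond; apply: eq_bigr => U UT.
have TUV (V : {set 'I_n}) : V \subset T :\: U ->
    T :\: U = V :|: (T :\: U :\: V).
  by move=> VT; rewrite -{1}(setID (T :\: U) V) (setIidPr VT).
apply: eq_big => [V|V /andP[VT _]].
  case: (boolP (V \subset _)) => //= VT.
  by rewrite {1}(TUV V VT) topU.
rewrite /triple_term {1}(TUV V VT) inversionsUr // -setI_eq0.
by rewrite setIDA setDIl setDv set0I.
Qed.

End Triple.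

(** * The differential *)

Lemma eq_signr (R : pzRingType) m m' :
  odd m = odd m' -> (-1) ^+ m = (-1) ^+ m' :> R.
Proof. by move=> e; rewrite -signr_odd e signr_odd. Qed.

Lemma subr_swap (V : zmodType) (a b c d : V) :
  a - b - (c - d) = a - c - (b - d).
Proof. by rewrite !opprB addrACA [- b - c]addrC addrACA. Qed.

Section Differential.
Variables (k : comPzRingType) (X : rack) (A : lmodType k).
Variables (mu : A -> A -> A) (mu_bilinear : is_bilinear mu).

Lemma cochain_d_linear n : linear (@cochain_d k X A n).
Proof.
move=> a f g; rewrite /cochain_d scaler_sumr -big_split /=.
apply: eq_bigr => i _; apply/funext => F.
rewrite !(addrfctE, scalrfctE, opprfctE) /=.
rewrite !scalerA [a * _]mulrC -!scalerA -!scalerDr; congr (_ *: _).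
by rewrite opprD addrACA -scalerBr.
Qed.

Lemma cochain_d_square p (f : cochain X A p) : cochain_d (cochain_d f) = 0.
Proof.
apply: cochain_atP => n F T B TB; rewrite at0 at_d //.
have TDB i : [disjoint T :\ i & B] by apply: disjointWl TB; exact: subsetDl.
have TDiB i : [disjoint T :\ i & i |: B] by rewrite disjointU1r ?setD11.
pose D i j :=
  cochain_at f F (T :\ i :\ j) B - cochain_at f F (T :\ i :\ j) (j |: B) -
  (cochain_at f F (T :\ i :\ j) (i |: B)
     - cochain_at f F (T :\ i :\ j) (j |: (i |: B))).
pose E i j :=
  (-1) ^+ (inversions [set i] T + inversions [set j] (T :\ i)) *: D i j.
transitivity (\sum_(i in T) \sum_(j in T | j != i) E i j).
  apply: eq_bigr => i iT; rewrite !at_d // -sumrB scaler_sumr.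
  apply: eq_big => [j|j _]; first by rewrite !inE andbC.
  by rewrite -scalerBr scalerA -exprD addSn addnS !exprS !mulN1r opprK.
(* Exchanging [i] and [j] preserves [D i j] and reverses the sign. *)
have E_anti i j : i \in T -> j \in T -> i != j -> E i j + E j i = 0.
  move=> iT jT ij; have DC : D j i = D i j.
    rewrite /D [T :\ j :\ i]setDDl [[set j] :|: _]setUC -setDDl.
    by rewrite [i |: (j |: B)]setUCA subr_swap.
  have e (a b : 'I_n) : a \in T ->
      inversions [set b] T = ((a < b) + inversions [set b] (T :\ a))%N.
    move=> aT; rewrite -{1}(setD1K aT) inversionsUr ?disjoints1 ?setD11 //.
    by rewrite /inversions !big_set1.
  rewrite /E DC -scalerDl [X in X *: _](_ : _ = 0) ?scale0r //.
  apply/eqP; rewrite addr_eq0; apply/eqP; rewrite -[RHS]mulN1r -exprS.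
  move: (e i j iT) (e j i jT) ij; rewrite neq_ltn.
  set a := inversions _ _; set b := inversions _ _.
  set a' := inversions _ _; set b' := inversions _ _ => eb ea ij.
  apply: eq_signr; rewrite eb ea.
  by case: ltngtP ij => // _ _; rewrite /= !oddD /=; do 4!case: odd.
rewrite (eq_bigr (fun i : 'I_n => \sum_(j in T | (j < i)%N) E i j
                         + \sum_(j in T | (i < j)%N) E i j)); last first.
  move=> i iT; rewrite (bigID (fun j : 'I_n => (j < i)%N)) /=; congr (_ + _).
    by apply: eq_bigl => j; rewrite -andbA -(inj_eq val_inj) /=; case: ltngtP.
  apply: eq_bigl => j; by rewrite -andbA -(inj_eq val_inj) /=; case: ltngtP.
rewrite big_split /= [X in _ + X](exchange_big_dep (mem T)) /=; last first.
  by move=> i j _ /andP[].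
rewrite -big_split big1 //= => i iT.
rewrite [X in _ + X](eq_bigl (fun j : 'I_n => (j \in T) && (j < i)%N));
  last first.
  by move=> j; rewrite iT.
rewrite -big_split big1 //= => j /andP[jT ji].
by apply: E_anti; rewrite // neq_ltn ji orbT.
Qed.

Section Leibniz.
Variables (p q : nat) (x : cochain X A p) (y : cochain X A q).
Variables (n : nat) (F : nerve X n) (T B : {set 'I_n}).
Hypothesis TB : [disjoint T & B].

(** The contribution to [d (x y)] of a direction [i] and of a partition of the
    other directions of [T] into [S] and [R]. *)
Definition d_prod_term (i : 'I_n) (S : {set 'I_n}) : A :=
  let R := T :\ i :\: S in
  (-1) ^+ ((inversions [set i] T).+1 + inversions S R) *:
  (mu (cochain_at x F S B) (cochain_at y F R (S :|: B)) -
   mu (cochain_at x F S (i |: B)) (cochain_at y F R (S :|: (i |: B)))).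

(** The contribution to [(d x) y], where [i] is a direction of [x]. *)
Definition d_left_term (i : 'I_n) (S : {set 'I_n}) : A :=
  let R := T :\ i :\: S in
  (-1) ^+ (inversions (i |: S) R + (inversions [set i] (i |: S)).+1) *:
  mu (cochain_at x F S B - cochain_at x F S (i |: B))
     (cochain_at y F R (i |: S :|: B)).

(** The contribution to [x (d y)], where [i] is a direction of [y]. *)
Definition d_right_term (i : 'I_n) (S : {set 'I_n}) : A :=
  let R := T :\ i :\: S in
  (-1) ^+ (inversions S (i |: R) + (inversions [set i] (i |: R)).+1) *:
  mu (cochain_at x F S B)
     (cochain_at y F R (S :|: B) - cochain_at y F R (i |: (S :|: B))).

Lemma at_d_prod b :
  cochain_at (cochain_d (half_prod mu b x y)) F T B =
  \sum_(i in T) \sum_(S : {set 'I_n} | (S \subset T :\ i) &&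
    ((top (T :\ i :\: S) < top S)%N == b)) d_prod_term i S.
Proof.
rewrite at_d //; apply: eq_bigr => i iT.
have TDB : [disjoint T :\ i & B] by apply: disjointWl TB; exact: subsetDl.
have TDiB : [disjoint T :\ i & i |: B] by rewrite disjointU1r ?setD11.
rewrite !(at_half mu_bilinear) // -sumrB scaler_sumr.
by apply: eq_bigr => S _; rewrite -scalerBr scalerA -exprD.
Qed.

Lemma at_d_left b :
  cochain_at (half_prod mu b (cochain_d x) y) F T B =
  \sum_(i in T) \sum_(S : {set 'I_n} | (S \subset T :\ i) &&
    ((top (T :\ i :\: S) < top (i |: S))%N == b)) d_left_term i S.
Proof.
rewrite (at_half mu_bilinear) //.
transitivity (\sum_(S : {set 'I_n} | (S \subset T) &&
    ((top (T :\: S) < top S)%N == b)) \sum_(i in S)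
  (-1) ^+ (inversions S (T :\: S) + (inversions [set i] S).+1) *:
  mu (cochain_at x F (S :\ i) B - cochain_at x F (S :\ i) (i |: B))
     (cochain_at y F (T :\: S) (S :|: B))).
  apply: eq_bigr => S /andP[ST _].
  have SB : [disjoint S & B] by apply: disjointWl TB.
  rewrite at_d // (mu_suml mu_bilinear) scaler_sumr; apply: eq_bigr => i _.
  by rewrite (muZl mu_bilinear) scalerA -exprD.
rewrite sum_first; apply: eq_bigr => i iT.
apply: eq_big => [S|S /andP[ST _]]; first by rewrite setDDl.
have iS : i \notin S by apply/negP => /(subsetP ST); rewrite setD11.
by rewrite /d_left_term setU1K // setDDl.
Qed.

Lemma at_d_right b :
  cochain_at (half_prod mu b x (cochain_d y)) F T B =
  \sum_(i in T) \sum_(S : {set 'I_n} | (S \subset T :\ i) &&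
    ((top (i |: (T :\ i :\: S)) < top S)%N == b)) d_right_term i S.
Proof.
rewrite (at_half mu_bilinear) //.
transitivity (\sum_(S : {set 'I_n} | (S \subset T) &&
    ((top (T :\: S) < top S)%N == b)) \sum_(i in T :\: S)
  (-1) ^+ (inversions S (T :\: S) + (inversions [set i] (T :\: S)).+1) *:
  mu (cochain_at x F S B)
     (cochain_at y F (T :\: S :\ i) (S :|: B)
      - cochain_at y F (T :\: S :\ i) (i |: (S :|: B)))).
  apply: eq_bigr => S /andP[ST _].
  have TSB : [disjoint T :\: S & S :|: B] by exact: disjoint_setDU.
  rewrite at_d // (mu_sumr mu_bilinear) scaler_sumr; apply: eq_bigr => i _.
  by rewrite (muZr mu_bilinear) scalerA -exprD.
rewrite sum_second; apply: eq_bigr => i iT.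
have TSi (S : {set 'I_n}) : S \subset T :\ i -> T :\: S = i |: (T :\ i :\: S).
  move=> ST; have iS : i \notin S.
    by apply/negP => /(subsetP ST); rewrite setD11.
  rewrite [T :\ i :\: S]setDDl [[set i] :|: S]setUC -setDDl.
  by rewrite setD1K // inE iS.
apply: eq_big => [S|S /andP[ST _]].
  by case: (boolP (S \subset _)) => //= ST; rewrite TSi.
rewrite /d_right_term -TSi // [T :\: S :\ i]setDDl.
by rewrite [S :|: [set i]]setUC -setDDl.
Qed.

Lemma leibniz_term i (S : {set 'I_n}) : i \in T -> S \subset T :\ i ->
  d_prod_term i S = d_left_term i S + (-1) ^+ p *: d_right_term i S.
Proof.
move=> iT ST; rewrite /d_prod_term /d_left_term /d_right_term.
set R := T :\ i :\: S.
have [cS|/eqP cS] := eqVneq #|S| p; last first.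
  rewrite !(at_card x _ _ cS) subr0 !(mu0l mu_bilinear) subrr !scaler0.
  by rewrite addr0.
have iS : i \notin S by apply/negP => /(subsetP ST); rewrite setD11.
have iR : i \notin R by rewrite !inE eqxx andbF.
have SR : [disjoint S & R] by rewrite -setI_eq0 setIDA setDIl setDv set0I.
have TE : T = i |: (S :|: R).
  by rewrite -[S in S :|: R](setIidPr ST) setID setD1K.
have iSR : i \notin S :|: R by rewrite inE negb_or iS.
rewrite {1}TE !inversions1U1 !inversionsUr ?inversionsUl ?disjoints1 //.
rewrite !addSn !addnS scalerA -exprD.
(* The number of elements of [S] is [p], and those smaller than [i] account for
   the sign of [i] in [d (x y)]. *)
have -> : (-1) ^+ (p + (inversions S [set i] + inversions S R
    + inversions [set i] R).+1) =
  (-1) ^+ (inversions [set i] S + inversions [set i] R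
           + inversions S R).+1 :> k.
  rewrite -cS -(inversions1C iS) addnS; apply: eq_signr; rewrite /= !oddD.
  by do 4!case: odd.
have -> : (inversions [set i] R + inversions S R + inversions [set i] S =
  inversions [set i] S + inversions [set i] R + inversions S R)%N.
  by rewrite addnC addnA.
rewrite -scalerDr; congr (_ *: _).
rewrite (muBl mu_bilinear) (muBr mu_bilinear) setUCA setUA.
by rewrite [RHS]addrC addrA subrK.
Qed.

(** Each of [x] and [y] takes the same value at base vertices that differ only
    by the largest direction [i]. *)
Lemma d_terms_larger (i : 'I_n) (S : {set 'I_n}) :
  (forall t, t \in T -> (t <= i)%N) -> i \in T ->
  S \subset T :\ i ->
  [/\ d_prod_term i S = 0, d_left_term i S = 0 & d_right_term i S = 0].
Proof.
move=> Ti iT ST; rewrite /d_prod_term /d_left_term /d_right_term.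
set R := T :\ i :\: S.
have iB : i \notin B by rewrite (disjointFr TB).
have iS : i \notin S by apply/negP => /(subsetP ST); rewrite setD11.
have lt_i (t : 'I_n) : t \in T :\ i -> (t < i)%N.
  rewrite !inE => /andP[ti /Ti].
  by rewrite leq_eqVlt (inj_eq val_inj) (negPf ti).
have TDB : [disjoint T :\ i & B] by apply: disjointWl TB; exact: subsetDl.
have -> : cochain_at x F S (i |: B) = cochain_at x F S B.
  apply: at_larger => // [t /(subsetP ST)/lt_i //|].
  exact: disjointWl TDB.
have -> : cochain_at y F R (i |: (S :|: B)) = cochain_at y F R (S :|: B).
  apply: at_larger => [t /setDP[/lt_i] //||].
    exact: disjoint_setDU.
  by rewrite inE negb_or iS.
have -> : cochain_at y F R (S :|: (i |: B)) = cochain_at y F R (S :|: B).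
  rewrite setUCA; apply: at_larger => [t /setDP[/lt_i] //||].
    exact: disjoint_setDU.
  by rewrite inE negb_or iS.
by rewrite !subrr (mu0l mu_bilinear) (mu0r mu_bilinear) !scaler0.
Qed.

Lemma at_leibniz b :
  cochain_at (cochain_d (half_prod mu b x y)) F T B =
  cochain_at (half_prod mu b (cochain_d x) y) F T B +
  (-1) ^+ p *: cochain_at (half_prod mu b x (cochain_d y)) F T B.
Proof.
rewrite at_d_prod at_d_left at_d_right scaler_sumr -big_split /=.
apply: eq_bigr => i iT.
case: (boolP [forall t in T, (t <= i)%N]) => [/forall_inP Ti|].
  rewrite !big1 ?scaler0 ?addr0 // => S /andP[ST _];
  by have [] := d_terms_larger Ti iT ST.
rewrite negb_forall_in => /exists_inP[t tT]; rewrite -ltnNge => it.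
(* The largest direction [t > i] is in the same block with or without [i]. *)
have eqC (S : {set 'I_n}) : S \subset T :\ i ->
  ((top (T :\ i :\: S) < top (i |: S)) = (top (T :\ i :\: S) < top S))%N /\
  ((top (i |: (T :\ i :\: S)) < top S) = (top (T :\ i :\: S) < top S))%N.
  move=> ST; have : (i.+1 < maxn (top S) (top (T :\ i :\: S)))%N.
    rewrite -topU; apply: (leq_ltn_trans it (ltn_top _)).
    rewrite -[S in S :|: _](setIidPr ST) setID !inE tT andbT.
    by apply: contraTneq it => ->; rewrite ltnn.
  rewrite !topU top1; split; apply/idP/idP; lia.
rewrite scaler_sumr.
rewrite [X in _ = X + _](eq_bigl (fun S : {set 'I_n} => (S \subset T :\ i) &&
    ((top (T :\ i :\: S) < top S)%N == b))); last first.
  by move=> S; case: (boolP (S \subset _)) => //= /eqC[-> _].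
rewrite [X in _ = _ + X](eq_bigl (fun S : {set 'I_n} => (S \subset T :\ i) &&
    ((top (T :\ i :\: S) < top S)%N == b))); last first.
  by move=> S; case: (boolP (S \subset _)) => //= /eqC[_ ->].
rewrite -big_split /=; apply: eq_bigr => S /andP[ST _].
exact: leibniz_term.
Qed.

End Leibniz.

Lemma half_prod_leibniz b p q (x : cochain X A p) (y : cochain X A q) :
  cochain_d (half_prod mu b x y) =
  half_prod mu b (cochain_d x) y +
  (-1) ^+ p *: deg_cast (D := cochain X A) (addnS p q)
                 (half_prod mu b x (cochain_d y)).
Proof.
apply: cochain_atP => n F T B TB.
by rewrite at_leibniz // atD atZ at_deg_cast.
Qed.

End Differential.

Theorem theorem4p3 (k : comPzRingType) (X : rack) (A : lmodType k)
    (mu : A -> A -> A) (mu_bilinear : is_bilinear mu)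
    (mu_assoc : associative mu) :
  @dg_dendriform k (cochain X A) (@succ_prod k X A mu) (@prec_prod k X A mu)
    (@cochain_d k X A).
Proof.
split; last 4 first.
- exact: cochain_d_linear.
- exact: cochain_d_square.
- exact: (half_prod_leibniz mu_bilinear false).
- exact: (half_prod_leibniz mu_bilinear true).
split.
- by move=> p q; exact: (half_prod_bilinear X mu_bilinear false).
- by move=> p q; exact: (half_prod_bilinear X mu_bilinear true).
- move=> p q r x y z; apply: cochain_atP => n F T B TB.
  rewrite at_deg_cast atD.
  rewrite (at_half_right mu_bilinear mu_assoc x y z F TB false false).
  (* Both sides keep the partitions whose largest direction is in the third set;
     the two terms on the right compare the largest elements of [U] and [V]. *)
  rewrite (at_half_left mu_bilinear x y z F TB false false).
  rewrite (at_half_left mu_bilinear x y z F TB true false).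
  rewrite -big_split /=; apply: eq_bigr => U UT.
  rewrite (bigID (fun V : {set 'I_n} => (top V < top U)%N)) addrC /=.
  congr (_ + _); apply: eq_bigl => V; rewrite -andbA; congr (_ && _);
  rewrite ?eqb_id ?eqbF_neg; apply/idP/idP; lia.
- move=> p q r x y z; apply: cochain_atP => n F T B TB.
  rewrite at_deg_cast.
  (* The largest direction is in the second set. *)
  rewrite (at_half_left mu_bilinear x y z F TB false true).
  rewrite (at_half_right mu_bilinear mu_assoc x y z F TB false true).
  apply: eq_bigr => U UT; apply: eq_bigl => V; congr (_ && _).
  rewrite ?eqb_id ?eqbF_neg; apply/idP/idP; lia.
move=> p q r x y z; apply: cochain_atP => n F T B TB.
rewrite at_deg_cast atD.
(* The largest direction is in the first set; the two terms on the right compare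
   the largest elements of [V] and [W]. *)
rewrite (at_half_left mu_bilinear x y z F TB true true).
rewrite (at_half_right mu_bilinear mu_assoc x y z F TB true true).
rewrite (at_half_right mu_bilinear mu_assoc x y z F TB true false).
rewrite -big_split /=; apply: eq_bigr => U UT.
rewrite (bigID (fun V : {set 'I_n} => (top (T :\: U :\: V) < top V)%N)) /=.
congr (_ + _); apply: eq_bigl => V; rewrite -andbA; congr (_ && _);
rewrite ?eqb_id ?eqbF_neg; apply/idP/idP; lia.
Qed.
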